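(* Let $(M,g)=(I\times N,\,dx^2+ds^2)$ be a Riemannian product, where $I\subset\mathbb{R}$ is an open interval. For any $v\in C^\infty(I)$, consider the vector field $V=v(x)\,\partial_x$. Then $$L_Vg=2v'(x)\,dx^2,\qquad L_VL_Vg=\bigl(2vv''+4(v')^2\bigr)\,dx^2 .$$ Consequently, (i) $V$ is mixed Killing on $\{v'\neq0\}$ with factor $f=v\,\frac{v''}{v'}+2v'$, and (ii) $V$ is conformally Killing if and only if $v'\equiv0$.
   Context: $x$ is the coordinate on $I$ and $ds^2$ denotes the Riemannian metric of the manifold $N$. $L_V$ is the Lie derivative. $V$ is mixed Killing with (mixed Killing) factor $f$, $f$ a smooth function, if $L_VL_Vg=f\,L_Vg$. $V$ is conformally Killing (conformal) if $L_Vg=2\lambda g$ for some smooth function $\lambda$. *)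

(* Defs.v *)
From HB Require Import structures.
From mathcomp Require Import all_boot all_order all_algebra.
From mathcomp Require Import all_classical all_reals all_analysis.
From mathcomp Require Import ring.

Set Implicit Arguments.
Unset Strict Implicit.
Unset Printing Implicit Defensive.

Import Order.TTheory GRing.Theory Num.Theory.
Import numFieldNormedType.Exports.

Local Open Scope classical_set_scope.
Local Open Scope ring_scope.

Section smooth_Rn.
Variables (R : realType) (n : nat).

(* Meant for an open U: continuity and derivability at y in U are those of the
   total function, and they only depend on it near y. *)
Fixpoint Ck (k : nat) (U : set 'rV[R]_n) (f : 'rV[R]_n -> R) : Prop :=
  (forall y, U y -> {for y, continuous f}) /\
  match k with
  | 0 => True
  | k'.+1 => forall j : 'I_n,
      (forall y, U y -> derivable f y (delta_mx 0 j)) /\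
      Ck k' U (fun y => 'D_(delta_mx 0 j) f y)
  end.

Definition smooth (U : set 'rV[R]_n) (f : 'rV[R]_n -> R) : Prop :=
  forall k, Ck k U f.

End smooth_Rn.

(* The underlying set of the manifold is the open subset [locus] of [space]
   (so that an open interval is carried by R itself).  The atlas is a family of
   charts, not necessarily maximal; [chinv i] is the inverse of [chart i] on
   the image of [dom i], and is arbitrary elsewhere. *)
Record manifold (R : realType) (n : nat) := Manifold {
  space :> topologicalType;
  locus : set space;
  atlas : Type;
  dom : atlas -> set space;
  chart : atlas -> space -> 'rV[R]_n;
  chinv : atlas -> 'rV[R]_n -> space;
  space_hausdorff : hausdorff_space space;
  space_second_countable : @second_countable space;
  locus_open : open locus;
  dom_open : forall i, open (dom i);
  dom_cover : \bigcup_i dom i = locus;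
  img_open : forall i, open (chart i @` dom i);
  chartK : forall i p, dom i p -> chinv i (chart i p) = p;
  chart_cont : forall i p, dom i p -> {for p, continuous (chart i)};
  chinv_cont : forall i y, (chart i @` dom i) y ->
    {for y, continuous (chinv i)};
  chart_compat : forall i j l, smooth (chart i @` (dom i `&` dom j))
    (fun y => chart j (chinv i y) 0 l)
}.

Arguments locus {R n} m _.

Section tensors.
Variables (R : realType) (n : nat) (M : manifold R n).
Implicit Types (i j : atlas M) (p : M) (U : set M) (f : M -> R).

Definition smooth_in i U f : Prop :=
  smooth (chart i @` (dom i `&` U)) (f \o chinv i).

Definition smooth_on U f : Prop := forall i, smooth_in i U f.

(* The coordinate derivative of f along the k-th coordinate of chart i. *)
Definition pd i f (k : 'I_n) p : R :=
  'D_(delta_mx 0 k) (f \o chinv i) (chart i p).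

Definition jac i j p : 'M[R]_n :=
  \matrix_(k, l) pd i (fun q => chart j q 0 l) k p.

(* Fields are given by their components in every chart: [X i p 0 k] is the
   coefficient of the k-th coordinate field of chart i in X at p, and
   [T i p a b] is the value of T on the a-th and b-th coordinate fields.  They
   are relevant for p in [dom i] only. *)
Definition vfield := atlas M -> M -> 'rV[R]_n.
Definition tensor02 := atlas M -> M -> 'M[R]_n.

Definition is_vfield (X : vfield) : Prop :=
  (forall i k, smooth_in i setT (fun p => X i p 0 k)) /\
  (forall i j p, dom i p -> dom j p -> X j p = X i p *m jac i j p).

Definition is_tensor02 (T : tensor02) : Prop :=
  (forall i a b, smooth_in i setT (fun p => T i p a b)) /\
  (forall i j p, dom i p -> dom j p ->
    T i p = jac i j p *m T j p *m (jac i j p)^T).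

Definition eval (A : 'M[R]_n) (u w : 'rV[R]_n) : R := (u *m A *m w^T) 0 0.

Definition riemannian_metric (g : tensor02) : Prop :=
  [/\ is_tensor02 g,
      forall i p, dom i p -> (g i p)^T = g i p &
      forall i p (u : 'rV[R]_n), dom i p -> u != 0 -> 0 < eval (g i p) u u].

Definition tadd (S T : tensor02) : tensor02 := fun i p => S i p + T i p.
Definition tscale f (T : tensor02) : tensor02 := fun i p => f p *: T i p.

Definition eq_tensor_on U (S T : tensor02) : Prop :=
  forall i p, dom i p -> U p -> S i p = T i p.

(* In the next two definitions X and Y are the components in chart i of vector
   fields. *)
Definition dir i (X : M -> 'rV[R]_n) f p : R :=
  \sum_k X p 0 k * pd i f k p.

Definition bracket i (X Y : M -> 'rV[R]_n) p : 'rV[R]_n :=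
  \row_k (dir i X (fun q => Y q 0 k) p - dir i Y (fun q => X q 0 k) p).

Definition frame (a : 'I_n) : M -> 'rV[R]_n := fun=> delta_mx 0 a.

(* (L_V T)(X, Y) = V (T(X, Y)) - T([V, X], Y) - T(X, [V, Y]), taken on the
   coordinate fields of each chart; [lieE] below is the formula for all X, Y *)
Definition lie (V : vfield) (T : tensor02) : tensor02 := fun i p =>
  \matrix_(a, b)
    (dir i (V i) (fun q => eval (T i q) (frame a q) (frame b q)) p
     - eval (T i p) (bracket i (V i) (frame a) p) (frame b p)
     - eval (T i p) (frame a p) (bracket i (V i) (frame b) p)).

Definition mixed_killing_on U (g : tensor02) (V : vfield) f : Prop :=
  smooth_on U f /\
  eq_tensor_on U (lie V (lie V g)) (tscale f (lie V g)).

Definition conformally_killing (g : tensor02) (V : vfield) : Prop :=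
  exists lambda : M -> R, smooth_on (locus M) lambda /\
    eq_tensor_on (locus M) (lie V g) (tscale (fun p => 2 * lambda p) g).

End tensors.

Section smooth_lemmas.
Variable R : realType.

Lemma CkS n k U (f : 'rV[R]_n -> R) : Ck k.+1 U f -> Ck k U f.
Proof.
elim: k f => [|k IH] f /=; first by case=> c _; split.
case=> c h; split=> // j; have [d [c' h']] := h j; split=> //.
by apply: IH; split.
Qed.

Lemma Ck_cst n k U (c : R) : Ck k U (fun _ : 'rV[R]_n => c).
Proof.
elim: k c => [|k IH] c; split=> //.
- by move=> y _; exact: cst_continuous.
- by move=> y _; exact: cst_continuous.
- move=> j; split=> [y _|]; first exact: derivable_cst.
  have -> : (fun y => 'D_(delta_mx 0 j) (fun _ : 'rV[R]_n => c) y) = fun=> 0.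
    by apply/funext => y; rewrite derive_cst.
  exact: IH.
Qed.

Lemma derive0v (V : normedModType R) (f : V -> R) a : 'D_0 f a = 0.
Proof.
rewrite /derive (_ : (fun h : R => _) = cst 0) ?lim_cst //.
by apply/funext => h /=; rewrite scaler0 add0r subrr scaler0.
Qed.

Lemma derivable0v (V : normedModType R) (f : V -> R) a : derivable f a 0.
Proof.
rewrite /derivable (_ : (fun h : R => _) = cst 0); first exact: is_cvg_cst.
by apply/funext => h /=; rewrite scaler0 add0r subrr scaler0.
Qed.

Section proj.
Variables (m p : nat) (pr : {linear 'rV[R]_p -> 'rV[R]_m}).
Hypothesis pr_cont : continuous pr.

Lemma derive_proj (f : 'rV[R]_m -> R) a v :
  'D_v (f \o pr) a = 'D_(pr v) f (pr a).
Proof.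
rewrite /derive; set F := (fun h : R => _); set G := (fun h : R => _).
suff -> : F = G by [].
by apply/funext => h; rewrite /F /G /= [pr (_ + _)]linearD [pr (_ *: _)]linearZ.
Qed.

Lemma derivable_proj (f : 'rV[R]_m -> R) a v :
  derivable f (pr a) (pr v) -> derivable (f \o pr) a v.
Proof.
rewrite /derivable; set F := (fun h : R => _); set G := (fun h : R => _).
suff -> : F = G by [].
by apply/funext => h; rewrite /F /G /= [pr (_ + _)]linearD [pr (_ *: _)]linearZ.
Qed.

Hypothesis pr_basis : forall j : 'I_p,
  pr (delta_mx 0 j) = 0 \/ exists k : 'I_m, pr (delta_mx 0 j) = delta_mx 0 k.

Lemma Ck_proj k (U : set 'rV[R]_p) (A : set 'rV[R]_m) f :
  (forall y, U y -> A (pr y)) -> Ck k A f -> Ck k U (f \o pr).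
Proof.
move=> UA; elim: k f => [|k IH] f [c h]; split => //.
- by move=> y Uy; apply: continuous_comp; [exact: pr_cont|apply: c; exact: UA].
- by move=> y Uy; apply: continuous_comp; [exact: pr_cont|apply: c; exact: UA].
- move=> j; have [e|[l e]] := pr_basis j.
    split=> [y _|]; first by apply: derivable_proj; rewrite e; exact: derivable0v.
    have -> : (fun y => 'D_(delta_mx 0 j) (f \o pr) y) = fun=> 0.
      by apply/funext => y; rewrite derive_proj e derive0v.
    exact: Ck_cst.
  have [d C] := h l; split=> [y Uy|].
    by apply: derivable_proj; rewrite e; apply: d; exact: UA.
  have -> : (fun y => 'D_(delta_mx 0 j) (f \o pr) y) =
            (fun y => 'D_(delta_mx 0 l) f y) \o pr.
    by apply/funext => y; rewrite derive_proj e.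
  exact: IH.
Qed.

Lemma smooth_proj (U : set 'rV[R]_p) (A : set 'rV[R]_m) f :
  (forall y, U y -> A (pr y)) -> smooth A f -> smooth U (f \o pr).
Proof. by move=> UA s k; exact: (Ck_proj UA (s k)). Qed.

End proj.

Lemma smooth_cst n U (c : R) : smooth U (fun _ : 'rV[R]_n => c).
Proof. by move=> k; exact: Ck_cst. Qed.

Lemma is_derive_coord n (l : 'I_n) (y v : 'rV[R]_n) :
  is_derive y v (fun z : 'rV[R]_n => z 0 l) (v 0 l).
Proof.
pose e h := (h^-1 *: (((fun z : 'rV[R]_n => z 0 l) \o shift y) (h *: v) - y 0 l)).
have E : e @ 0^' --> v 0 l.
  apply: (@cvg_trans _ (cst (v 0 l) @ 0^')); last exact: cvg_cst.
  apply: near_eq_cvg; near=> h.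
  rewrite /e /= !mxE addrK scalerA mulVf ?scale1r //.
  by near: h; exact: nbhs_dnbhs_neq.
apply: DeriveDef; first by apply/cvg_ex; exists (v 0 l).
by apply: cvg_lim E.
Unshelve. all: by end_near. Qed.

Lemma smooth_coord n U (l : 'I_n) : smooth U (fun y : 'rV[R]_n => y 0 l).
Proof.
case=> [|k]; split=> //.
- by move=> y _; exact: coord_continuous.
- by move=> y _; exact: coord_continuous.
move=> j; split=> [y _|].
  by have [] := is_derive_coord l y (delta_mx 0 j).
have -> : (fun y => 'D_(delta_mx 0 j) (fun z : 'rV[R]_n => z 0 l) y) =
          fun=> (delta_mx 0 j : 'rV[R]_n) 0 l.
  by apply/funext => y; have [] := is_derive_coord l y (delta_mx 0 j).
exact: Ck_cst.
Qed.

Section blocks.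
Variables (m n : nat).

Lemma lsubmx_continuous : continuous (@lsubmx R 1 m n).
Proof.
move=> y A [P yP PA]; pose Q (i : 'I_1) (j : 'I_(m + n)) :=
  [set z | forall j', j = lshift n j' -> P i j' z].
exists Q => [i j|z Qz].
  case: (split_ordP j) => j' ej; subst j.
    have := yP i j'; rewrite mxE; apply: filterS => z Pz j'' /lshift_inj <- //.
  by apply: filterE => z j'' /eqP; rewrite eq_rlshift.
by apply: PA => i j; rewrite mxE; exact: Qz.
Qed.

Lemma rsubmx_continuous : continuous (@rsubmx R 1 m n).
Proof.
move=> y A [P yP PA]; pose Q (i : 'I_1) (j : 'I_(m + n)) :=
  [set z | forall j', j = rshift m j' -> P i j' z].
exists Q => [i j|z Qz].
  case: (split_ordP j) => j' ej; subst j.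
    by apply: filterE => z j'' /eqP; rewrite eq_lrshift.
  have := yP i j'; rewrite mxE; apply: filterS => z Pz j'' /rshift_inj <- //.
by apply: PA => i j; rewrite mxE; exact: Qz.
Qed.

Lemma row_mx_cvg (T : topologicalType) (f : T -> 'rV[R]_m) (g : T -> 'rV[R]_n) x :
  {for x, continuous f} -> {for x, continuous g} ->
  {for x, continuous (fun t => row_mx (f t) (g t))}.
Proof.
move=> cf cg A [P xP PA].
have cf' : nbhs x [set t | forall i j, P i (lshift n j) (f t i j)].
  apply: (cf [set y | forall i j, P i (lshift n j) (y i j)]).
  exists (fun i j => P i (lshift n j)) => // i j.
  by have := xP i (lshift n j); rewrite row_mxEl.
have cg' : nbhs x [set t | forall i j, P i (rshift m j) (g t i j)].
  apply: (cg [set y | forall i j, P i (rshift m j) (y i j)]).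
  exists (fun i j => P i (rshift m j)) => // i j.
  by have := xP i (rshift m j); rewrite row_mxEr.
apply: filterS (filterI cf' cg') => t [ft gt] /=; apply: PA => i j.
by case: (split_ordP j) => j' ->; rewrite ?row_mxEl ?row_mxEr.
Qed.

Lemma lsubmx_delta_l (j : 'I_m) :
  lsubmx (delta_mx 0 (lshift n j) : 'rV[R]_(m + n)) = delta_mx 0 j.
Proof. by apply/rowP => l; rewrite !mxE (inj_eq (@lshift_inj m n)). Qed.

Lemma lsubmx_delta_r (j : 'I_n) :
  lsubmx (delta_mx 0 (rshift m j) : 'rV[R]_(m + n)) = 0.
Proof. by apply/rowP => l; rewrite !mxE eq_lrshift andbF. Qed.

Lemma rsubmx_delta_l (j : 'I_m) :
  rsubmx (delta_mx 0 (lshift n j) : 'rV[R]_(m + n)) = 0.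
Proof. by apply/rowP => l; rewrite !mxE eq_rlshift andbF. Qed.

Lemma rsubmx_delta_r (j : 'I_n) :
  rsubmx (delta_mx 0 (rshift m j) : 'rV[R]_(m + n)) = delta_mx 0 j.
Proof. by apply/rowP => l; rewrite !mxE (inj_eq (@rshift_inj m n)). Qed.

Lemma smooth_lsub (U : set 'rV[R]_(m + n)) (A : set 'rV[R]_m) f :
  (forall y, U y -> A (lsubmx y)) -> smooth A f -> smooth U (f \o lsubmx).
Proof.
apply: smooth_proj; first exact: lsubmx_continuous.
move=> j; case: (split_ordP j) => j' ->.
  by right; exists j'; exact: lsubmx_delta_l.
by left; exact: lsubmx_delta_r.
Qed.

Lemma smooth_rsub (U : set 'rV[R]_(m + n)) (A : set 'rV[R]_n) f :
  (forall y, U y -> A (rsubmx y)) -> smooth A f -> smooth U (f \o rsubmx).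
Proof.
apply: smooth_proj; first exact: rsubmx_continuous.
move=> j; case: (split_ordP j) => j' ->.
  by left; exact: rsubmx_delta_l.
by right; exists j'; exact: rsubmx_delta_r.
Qed.

End blocks.
End smooth_lemmas.

Section lie_leibniz.
Variables (R : realType) (n : nat) (M : manifold R n).
Variables (i : atlas M) (p : M) (V : vfield M).

Definition derivable_in (f : M -> R) : Prop :=
  forall k, derivable (f \o chinv i) (chart i p) (delta_mx 0 k).

Lemma dir_cst (X : M -> 'rV[R]_n) (c : R) : dir i X (fun=> c) p = 0.
Proof.
rewrite /dir big1 // => k _; rewrite /pd (_ : _ \o _ = cst c) //.
by rewrite derive_cst mulr0.
Qed.

Lemma dirM (X : M -> 'rV[R]_n) (f g : M -> R) :
  dom i p -> derivable_in f -> derivable_in g ->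
  dir i X (fun q => f q * g q) p = dir i X f p * g p + f p * dir i X g p.
Proof.
move=> dp df dg; rewrite /dir mulr_suml mulr_sumr -big_split /=.
apply: eq_bigr => k _; rewrite /pd.
rewrite (_ : (fun q => f q * g q) \o chinv i = (f \o chinv i) * (g \o chinv i)) //.
rewrite deriveM //= chartK // /GRing.scale /= mulrDr addrC; congr (_ + _).
  by rewrite mulrCA.
by rewrite [g p * _]mulrC mulrA.
Qed.

Lemma derivable_inM (f g : M -> R) :
  derivable_in f -> derivable_in g -> derivable_in (fun q => f q * g q).
Proof. by move=> df dg k; exact: derivableM (df k) (dg k). Qed.

Lemma dir_sum (X : M -> 'rV[R]_n) (f : 'I_n -> M -> R) :
  (forall a, derivable_in (f a)) ->
  dir i X (fun q => \sum_a f a q) p = \sum_a dir i X (f a) p.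
Proof.
move=> df; rewrite /dir exchange_big /=; apply: eq_bigr => k _.
rewrite -mulr_sumr; congr (_ * _); rewrite /pd.
have -> : (fun q => \sum_a f a q) \o chinv i = \sum_a (f a \o chinv i).
  by apply/funext => y; rewrite /= fct_sumE.
by rewrite derive_sum // => a; exact: df.
Qed.

Lemma derivable_in_sum (f : 'I_n -> M -> R) :
  (forall a, derivable_in (f a)) -> derivable_in (fun q => \sum_a f a q).
Proof.
move=> df k.
have -> : (fun q => \sum_a f a q) \o chinv i = \sum_a (f a \o chinv i).
  by apply/funext => y; rewrite /= fct_sumE.
by apply: derivable_sum => a; exact: df.
Qed.

Definition vjac : 'M[R]_n := \matrix_(a, k) pd i (fun q => V i q 0 k) a p.
Definition dirmx m1 m2 (A : M -> 'M[R]_(m1, m2)) : 'M[R]_(m1, m2) :=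
  \matrix_(a, b) dir i (V i) (fun q => A q a b) p.

Lemma bracketE (X : M -> 'rV[R]_n) :
  bracket i (V i) X p = dirmx X - X p *m vjac.
Proof.
by apply/rowP => k; rewrite !mxE; congr (_ - _); apply: eq_bigr => l _; rewrite mxE.
Qed.

Lemma evalE (A : 'M[R]_n) u w : eval A u w = \sum_b (\sum_a u 0 a * A a b) * w 0 b.
Proof. by rewrite /eval mxE; apply: eq_bigr => b _; rewrite !mxE. Qed.

Lemma eval_frame (A : 'M[R]_n) a b q q' : eval A (frame (M := M) a q) (frame (M := M) b q') = A a b.
Proof. by rewrite /eval /frame -rowE trmx_delta -colE !mxE. Qed.

Lemma lie_mxE (T : tensor02 M) :
  lie V T i p = dirmx (T i) + vjac *m T i p + T i p *m vjac^T.
Proof.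
have DF a : dirmx (frame (M := M) a) = 0.
  by apply/matrixP => x y; rewrite [LHS]mxE /frame dir_cst mxE.
have FJ a : frame (M := M) a p *m vjac = row a vjac by rewrite rowE.
have N1 (A : 'M[R]_1) : (- A) 0 0 = - A 0 0 by rewrite mxE.
apply/matrixP => a b; rewrite [LHS]mxE [RHS]mxE [X in _ = X + _]mxE.
rewrite [X in _ = X + _ + _]mxE !bracketE !DF !sub0r !FJ.
under [X in dir i _ X]eq_fun => q do rewrite eval_frame.
rewrite /eval !mulNmx linearN /= mulmxN !N1 !opprK; congr (_ + _ + _).
  by rewrite /frame trmx_delta -colE -row_mul [LHS]mxE [LHS]mxE.
by rewrite /frame -rowE tr_row !mxE; apply: eq_bigr => k _; rewrite !mxE.
Qed.

Lemma lieE (T : tensor02 M) (X Y : M -> 'rV[R]_n) :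
  dom i p ->
  (forall a b, derivable_in (fun q => T i q a b)) ->
  (forall a, derivable_in (fun q => X q 0 a)) ->
  (forall a, derivable_in (fun q => Y q 0 a)) ->
  eval (lie V T i p) (X p) (Y p) =
  dir i (V i) (fun q => eval (T i q) (X q) (Y q)) p
  - eval (T i p) (bracket i (V i) X p) (Y p)
  - eval (T i p) (X p) (bracket i (V i) Y p).
Proof.
move=> dp dT dX dY.
have dXT b : derivable_in (fun q => \sum_a X q 0 a * T i q a b).
  by apply: derivable_in_sum => a; exact: derivable_inM.
have -> : dir i (V i) (fun q => eval (T i q) (X q) (Y q)) p =
  eval (T i p) (dirmx X) (Y p) + eval (dirmx (T i)) (X p) (Y p) + eval (T i p) (X p) (dirmx Y).
  under [X in dir i _ X]eq_fun => q do rewrite evalE.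
  rewrite dir_sum; last by move=> b; exact: derivable_inM.
  rewrite !evalE -!big_split /=; apply: eq_bigr => b _.
  rewrite dirM // [dirmx Y 0 b]mxE; congr (_ + _).
  rewrite dir_sum; last by move=> a; exact: derivable_inM.
  rewrite -mulrDl -big_split /=; congr (_ * _); apply: eq_bigr => a _.
  by rewrite dirM // !mxE.
rewrite lie_mxE !bracketE /eval [(dirmx Y - _)^T]linearB /= trmx_mul.
rewrite !(mulmxDl, mulmxDr, mulmxBl, mulmxBr, mulmxN, mulNmx) !mulmxA.
have N1 (A : 'M[R]_1) : (- A) 0 0 = - A 0 0 by rewrite mxE.
have D1 (A B : 'M[R]_1) : (A + B) 0 0 = A 0 0 + B 0 0 by rewrite mxE.
rewrite !(D1, N1) !opprD !opprK.
ring.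
Qed.

End lie_leibniz.

Section topology_lemmas.

Lemma hausdorff_pair (S T : topologicalType) :
  hausdorff_space S -> hausdorff_space T -> hausdorff_space (S * T)%type.
Proof.
move=> hS hT [s t] [s' t'] cl; congr pair.
- apply: hS => A B sA s'B.
  have [] := cl (A `*` setT) (B `*` setT).
  + by exists (A, setT) => //; split=> //; exact: filterT.
  + by exists (B, setT) => //; split=> //; exact: filterT.
  by move=> [a b] [[Aa _] [Ba _]]; exists a.
- apply: hT => A B tA t'B.
  have [] := cl (setT `*` A) (setT `*` B).
  + by exists (setT, A) => //; split=> //; exact: filterT.
  + by exists (setT, B) => //; split=> //; exact: filterT.
  by move=> [a b] [[_ Aa] [_ Ba]]; exists b.
Qed.

Lemma open_setX (S T : topologicalType) (A : set S) (B : set T) :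
  open A -> open B -> open (A `*` B).
Proof.
rewrite !openE => oA oB [s t] [/= As Bt]; exists (A, B) => //.
by split; [exact: oA|exact: oB].
Qed.

Lemma second_countable_pair (S T : topologicalType) :
  @second_countable S -> @second_countable T ->
  @second_countable (S * T)%type.
Proof.
move=> [B cB [oB bB]] [C cC [oC bC]].
exists ((fun U => U.1 `*` U.2) @` (B `*` C)).
  by apply: sub_countable (card_image_le _ _) _; exact: countableX.
split=> [_ [[U1 U2] /= [/oB o1 /oC o2] <-]|[s t] A].
  exact: open_setX.
case=> -[A1 A2] /= [/bB [U1 [BU1 U1s] U1A] /bC [U2 [CU2 U2t] U2A]] sA.
exists (U1 `*` U2); first by split=> //; exists (U1, U2).
by move=> [a b] [/U1A ? /U2A ?]; exact: sA.
Qed.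

Lemma second_countable_R (R : realType) : @second_countable R.
Proof.
exists (range (fun q : rat * rat => `]ratr q.1, ratr q.2[%classic : set R)).
  by apply: sub_countable (card_image_le _ _) _; exact: countableP.
split=> [_ [q _ <-]|x A /nbhs_ballP [e /= e0 eA]].
  exact: interval_open.
have /rat_in_itvoo [a] : x - e < x by rewrite ltrBlDr ltrDl.
have /rat_in_itvoo [b] : x < x + e by rewrite ltrDl.
rewrite !in_itv /= => /andP[xb be] /andP[ea ax].
exists `]ratr a, ratr b[%classic.
  by split=> /=; [exists (a, b)|rewrite in_itv /= ax xb].
move=> y /=; rewrite in_itv /= => /andP[ay yb]; apply: eA.
by rewrite /ball /= distrC ltr_distl (lt_trans ea ay) (lt_trans yb be).
Qed.
End topology_lemmas.

Section interval_manifold.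
Variables (R : realType) (I : set R).
Hypothesis oI : open I.

Let ichart (_ : unit) (x : R) : 'rV[R]_1 := const_mx x.
Let ichinv (_ : unit) (y : 'rV[R]_1) : R := y 0 0.

Let ichart_img i (U : set R) : ichart i @` U = [set y | U (y 0 0)].
Proof.
apply/seteqP; split=> [_ [x Ux <-]|y Uy] /=; first by rewrite mxE.
by exists (y 0 0) => //; apply/rowP => k; rewrite mxE ord1.
Qed.

Let ichart_cont i x : {for x, continuous (ichart i)}.
Proof.
move=> A [P xP PA]; have := xP 0 0; rewrite mxE => Px.
by apply: filterS Px => t Pt; apply: PA => a b; rewrite !ord1 mxE.
Qed.

Let ichinv_cont i y : {for y, continuous (ichinv i)}.
Proof. exact: coord_continuous. Qed.

Let img_open_ i : open (ichart i @` I).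
Proof.
rewrite ichart_img; apply: (@open_comp _ _ (ichinv i)) => // y _.
exact: ichinv_cont.
Qed.

Let cover_ : \bigcup_(_ : unit) I = I.
Proof. by apply/seteqP; split=> [x [[]]//|x Ix]; exists tt. Qed.

Let compat_ (i j : unit) l : smooth (ichart i @` (I `&` I))
  (fun y => ichart j (ichinv i y) 0 l).
Proof.
have -> : (fun y => ichart j (ichinv i y) 0 l) = fun y => y 0 0.
  by apply/funext => y; rewrite /ichart mxE.
exact: smooth_coord.
Qed.

Let chartK_ (i : unit) x : I x -> ichinv i (ichart i x) = x.
Proof. by move=> _; rewrite /ichinv /ichart mxE. Qed.

Definition interval_manifold : manifold R 1 := @Manifold R 1 R I unit (fun=> I)
  ichart ichinv (@Rhausdorff R) (@second_countable_R R) oI (fun=> oI) cover_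
  img_open_ chartK_ (fun i x _ => @ichart_cont i x)
  (fun i y _ => @ichinv_cont i y) compat_.

End interval_manifold.

Section product_manifold.
Variables (R : realType) (m n : nat) (M : manifold R m) (N : manifold R n).

Let pdom (i : atlas M * atlas N) : set (M * N) := dom i.1 `*` dom i.2.
Let pchart (i : atlas M * atlas N) (p : M * N) : 'rV[R]_(m + n) :=
  row_mx (chart i.1 p.1) (chart i.2 p.2).
Let pchinv (i : atlas M * atlas N) (y : 'rV[R]_(m + n)) : M * N :=
  (chinv i.1 (lsubmx y), chinv i.2 (rsubmx y)).

Let pimg i (A : set M) (B : set N) : pchart i @` (A `*` B) =
  [set y | (chart i.1 @` A) (lsubmx y) /\ (chart i.2 @` B) (rsubmx y)].
Proof.
apply/seteqP; split=> [_ [[p q] [/= Ap Bq] <-]|y [[p Ap ep] [q Bq eq]]] /=.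
  by rewrite row_mxKl row_mxKr; split; [exists p|exists q].
by exists (p, q) => //; rewrite /pchart /= ep eq hsubmxK.
Qed.

Let phausdorff : hausdorff_space (M * N)%type.
Proof. by apply: hausdorff_pair; exact: space_hausdorff. Qed.

Let psecond : @second_countable (M * N)%type.
Proof. by apply: second_countable_pair; exact: space_second_countable. Qed.

Let popen : open (locus M `*` locus N).
Proof. by apply: open_setX; exact: locus_open. Qed.

Let pdom_open i : open (pdom i).
Proof. by apply: open_setX; exact: dom_open. Qed.

Let pcover : \bigcup_i pdom i = locus M `*` locus N.
Proof.
rewrite -!dom_cover; apply/seteqP; split=> [p [i _ [d1 d2]]|p].
  by split; [exists i.1|exists i.2].
by move=> [[i _ di] [j _ dj]]; exists (i, j).
Qed.

Let pimg_open i : open (pchart i @` pdom i).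
Proof.
rewrite pimg; apply: openI.
  apply: (@open_comp _ _ (@lsubmx R 1 m n)); last exact: img_open.
  by move=> y _; exact: lsubmx_continuous.
apply: (@open_comp _ _ (@rsubmx R 1 m n)); last exact: img_open.
by move=> y _; exact: rsubmx_continuous.
Qed.

Let pchartK i p : pdom i p -> pchinv i (pchart i p) = p.
Proof.
by case: p => p q [/= dp dq]; rewrite /pchinv row_mxKl row_mxKr !chartK.
Qed.

Let pchart_cont i p : pdom i p -> {for p, continuous (pchart i)}.
Proof.
case: p => p q [/= dp dq]; apply: row_mx_cvg.
  apply: (@continuous_comp _ _ _ fst (chart i.1)); first exact: cvg_fst.
  exact: chart_cont.
apply: (@continuous_comp _ _ _ snd (chart i.2)); first exact: cvg_snd.
exact: chart_cont.
Qed.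

Let pchinv_cont i y : (pchart i @` pdom i) y -> {for y, continuous (pchinv i)}.
Proof.
rewrite pimg => -[y1 y2].
have c1 : {for y, continuous (chinv i.1 \o @lsubmx R 1 m n)}.
  by apply: continuous_comp; [exact: lsubmx_continuous|exact: chinv_cont].
have c2 : {for y, continuous (chinv i.2 \o @rsubmx R 1 m n)}.
  by apply: continuous_comp; [exact: rsubmx_continuous|exact: chinv_cont].
exact: cvg_pair c1 c2.
Qed.

Let pcompat i j l : smooth (pchart i @` (pdom i `&` pdom j))
  (fun y => pchart j (pchinv i y) 0 l).
Proof.
have -> : pdom i `&` pdom j = (dom i.1 `&` dom j.1) `*` (dom i.2 `&` dom j.2).
  by rewrite /pdom setXI.
rewrite pimg; case: (split_ordP l) => l' ->.
  have -> : (fun y => pchart j (pchinv i y) 0 (lshift n l')) =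
    (fun y => chart j.1 (chinv i.1 y) 0 l') \o lsubmx.
    by apply/funext => y; rewrite /pchart row_mxEl.
  by apply: smooth_lsub; [move=> y [h _]; exact: h|exact: chart_compat].
have -> : (fun y => pchart j (pchinv i y) 0 (rshift m l')) =
  (fun y => chart j.2 (chinv i.2 y) 0 l') \o rsubmx.
  by apply/funext => y; rewrite /pchart row_mxEr.
by apply: smooth_rsub; [move=> y [_ h]; exact: h|exact: chart_compat].
Qed.

Definition product_manifold : manifold R (m + n) :=
  @Manifold R (m + n) (M * N)%type (locus M `*` locus N) (atlas M * atlas N)%type
    pdom pchart pchinv phausdorff psecond popen pdom_open pcover pimg_open pchartK
    pchart_cont pchinv_cont pcompat.

Definition lift_fst (X : vfield M) : vfield product_manifold :=
  fun i p => row_mx (X i.1 p.1) 0.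

(* The pullbacks of (0,2)-tensors by the two projections. *)
Definition pull_fst (T : tensor02 M) : tensor02 product_manifold :=
  fun i p => block_mx (T i.1 p.1) 0 0 0.
Definition pull_snd (T : tensor02 N) : tensor02 product_manifold :=
  fun i p => block_mx 0 0 0 (T i.2 p.2).

Definition product_metric (g : tensor02 M) (h : tensor02 N) :
  tensor02 product_manifold := tadd (pull_fst g) (pull_snd h).

Lemma jac_product (i j : atlas product_manifold) (p : product_manifold) :
  jac i j p = block_mx (jac i.1 j.1 p.1) 0 0 (jac i.2 j.2 p.2).
Proof.
have El k : (fun q : product_manifold => chart j q 0 (lshift n k)) \o chinv i =
  ((fun q => chart j.1 q 0 k) \o chinv i.1) \o lsubmx.
  by apply/funext => y /=; rewrite /pchart row_mxEl.
have Er k : (fun q : product_manifold => chart j q 0 (rshift m k)) \o chinv i =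
  ((fun q => chart j.2 q 0 k) \o chinv i.2) \o rsubmx.
  by apply/funext => y /=; rewrite /pchart row_mxEr.
apply/matrixP => a b; rewrite mxE /pd.
case: (split_ordP b) => b' ->; rewrite ?El ?Er derive_proj /= /pchart;
  case: (split_ordP a) => a' ->;
  rewrite ?row_mxKl ?row_mxKr ?lsubmx_delta_l ?lsubmx_delta_r ?rsubmx_delta_l
    ?rsubmx_delta_r ?derive0v ?block_mxEul ?block_mxEur ?block_mxEdl ?block_mxEdr
    !mxE //.
Qed.

End product_manifold.

Arguments lift_fst {R m n M} N X _ _.
Arguments pull_fst {R m n M} N T _ _.
Arguments pull_snd {R m n} M {N} T _ _.

Section product_fields.
Variables (R : realType) (m n : nat) (M : manifold R m) (N : manifold R n).
Let P := product_manifold M N.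

Lemma smooth_in_fst (i : atlas P) (f : M -> R) :
  smooth_in i.1 setT f -> smooth_in i setT (fun p : P => f p.1).
Proof.
move=> sf; apply: (@smooth_lsub _ _ _ _ _ (f \o chinv i.1)); last exact: sf.
move=> _ [[p q] [[/= dp dq] _] <-] /=; rewrite row_mxKl.
by exists p.
Qed.

Lemma smooth_in_snd (i : atlas P) (f : N -> R) :
  smooth_in i.2 setT f -> smooth_in i setT (fun p : P => f p.2).
Proof.
move=> sf; apply: (@smooth_rsub _ _ _ _ _ (f \o chinv i.2)); last exact: sf.
move=> _ [[p q] [[/= dp dq] _] <-] /=; rewrite row_mxKr.
by exists q.
Qed.

Lemma is_vfield_lift_fst (X : vfield M) :
  is_vfield X -> is_vfield (lift_fst N X).
Proof.
move=> [sX tX]; split=> [i k|i j p [di1 di2] [dj1 dj2]].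
  rewrite /lift_fst; case: (split_ordP k) => k' ->.
    under [fun p => _]eq_fun => q do rewrite row_mxEl.
    exact: (@smooth_in_fst i (fun p => X i.1 p 0 k') (sX _ _)).
  under [fun p => _]eq_fun => q do rewrite row_mxEr mxE.
  exact: smooth_cst.
by rewrite jac_product /lift_fst mul_row_block !mulmx0 !mul0mx !addr0 (tX i.1 j.1).
Qed.

Lemma product_metricE (g : tensor02 M) (h : tensor02 N) (i : atlas P) (p : P) :
  product_metric g h i p = block_mx (g i.1 p.1) 0 0 (h i.2 p.2).
Proof.
by rewrite /product_metric /tadd /pull_fst /pull_snd add_block_mx !addr0 !add0r.
Qed.

Lemma riemannian_product (g : tensor02 M) (h : tensor02 N) :
  riemannian_metric g -> riemannian_metric h ->
  riemannian_metric (product_metric g h).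
Proof.
move=> [[sg tg] gT gp] [[sh th] hT hp]; split.
- split=> [i a b|i j p [di1 di2] [dj1 dj2]].
    under [fun p => _]eq_fun => q do rewrite product_metricE.
    case: (split_ordP a) => a' ->; case: (split_ordP b) => b' ->.
    + under [fun p => _]eq_fun => q do rewrite block_mxEul.
      exact: (@smooth_in_fst i (fun p => g i.1 p a' b') (sg _ _ _)).
    + under [fun p => _]eq_fun => q do rewrite block_mxEur mxE.
      exact: smooth_cst.
    + under [fun p => _]eq_fun => q do rewrite block_mxEdl mxE.
      exact: smooth_cst.
    + under [fun p => _]eq_fun => q do rewrite block_mxEdr.
      exact: (@smooth_in_snd i (fun p => h i.2 p a' b') (sh _ _ _)).
  rewrite !product_metricE jac_product tr_block_mx !trmx0 !mulmx_block.
  by rewrite !(mulmx0, mul0mx, addr0, add0r) -(tg i.1 j.1) // -(th i.2 j.2).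
- move=> i p [d1 d2].
  by rewrite !product_metricE tr_block_mx !trmx0 gT // hT.
- move=> i p u [d1 d2] u0; rewrite product_metricE /eval.
  rewrite -[u]hsubmxK mul_row_block tr_row_mx mul_row_col.
  rewrite !mulmx0 addr0 add0r mxE.
  have nn k (A : 'M[R]_k) (w : 'rV[R]_k) :
    (w != 0 -> 0 < eval A w w) -> 0 <= eval A w w.
    have [-> _|w0 /(_ isT)/ltW//] := eqVneq w 0.
    by rewrite /eval !mul0mx mxE.
  have [l0|l0] := eqVneq (lsubmx u) 0.
    have r0 : rsubmx u != 0.
      by apply: contra u0 => /eqP r0; rewrite -[u]hsubmxK l0 r0 row_mx0.
    by apply: ltr_wpDl; [apply: nn => w0; exact: gp|exact: hp].
  by apply: ltr_pwDl; [exact: gp|apply: nn => w0; exact: hp].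
Qed.

End product_fields.

Section interval_fields.
Variables (R : realType) (I : set R) (oI : open I).
Let L := interval_manifold oI.

Definition dx2 : tensor02 L := fun _ _ => 1%:M.
Definition vdx (v : R -> R) : vfield L := fun _ x => const_mx (v x).

Lemma jac_interval (i j : atlas L) (x : L) : jac i j x = 1%:M.
Proof.
apply/matrixP => a b; rewrite !ord1 !mxE /pd /=.
rewrite (_ : _ \o _ = fun y : 'rV[R]_1 => y 0 0); last first.
  by apply/funext => y /=; rewrite mxE.
have [_ ->] := is_derive_coord (0 : 'I_1) (const_mx x) (delta_mx 0 0).
by rewrite mxE.
Qed.

Lemma is_vfield_vdx (v : R -> R) : smooth_on (M := L) I v -> is_vfield (vdx v).
Proof.
move=> sv; split=> [i k|i j p _ _]; last by rewrite jac_interval mulmx1.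
rewrite /vdx; under [fun p => _]eq_fun => q do rewrite mxE.
by have := sv i; rewrite /smooth_in /= setIid setIT.
Qed.

Lemma riemannian_dx2 : riemannian_metric dx2.
Proof.
split=> [|i x _|i x u _ u0]; last 1 first.
- rewrite /eval mulmx1 mxE big_ord1 mxE -expr2 exprn_even_gt0 //=.
  by apply: contra u0 => /eqP e; apply/eqP/rowP => k; rewrite ord1 e mxE.
- by split=> [i a b|i j x _ _]; [exact: smooth_cst|
    rewrite !jac_interval trmx1 !mulmx1].
- exact: trmx1.
Qed.

End interval_fields.

Arguments dx2 {R I} oI _ _.
Arguments vdx {R I} oI v _ _.

(* Main.v *)
(** In a product chart the only nonzero component of [V] is [v], and its only
    nonzero derivative is [v'] in the direction of [I].  Hence, for every function
    [h] of [x] and every tensor [T] on [N],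
    [L_V (h dx^2 + T) = (v h' + 2 h v') dx^2].  Taking [h = 1], [T = ds^2] and then
    [h = 2 v'], [T = 0] gives both Lie derivatives.  If [L_V g = 2 lambda g], the
    [N]-block reads [0 = 2 lambda ds^2], which forces [lambda = 0]. *)
Require Import Defs.
From mathcomp Require Import all_boot all_order all_algebra.
From mathcomp Require Import all_classical all_reals all_analysis.
From mathcomp Require Import ring.

Set Implicit Arguments.
Unset Strict Implicit.
Unset Printing Implicit Defensive.

Import Order.TTheory GRing.Theory Num.Theory.
Import numFieldNormedType.Exports.
Local Open Scope classical_set_scope.
Local Open Scope ring_scope.

(** * Algebra of [Ck] functions on an open set *)

Section smooth_algebra.
Variables (R : realType) (n : nat) (U : set 'rV[R]_n).
Hypothesis oU : open U.
Implicit Types f g : 'rV[R]_n -> R.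

(** [Ck] concerns total functions, while the differentiation rules used below are available only at
    points of [U]. As [U] is open, agreement on [U] is agreement near each of its points, so
    continuity and directional derivatives transfer. *)
Lemma Ck_eq k f g : (forall y, U y -> f y = g y) -> Ck k U f -> Ck k U g.
Proof.
move=> fg; have nfg (h h' : 'rV[R]_n -> R) : (forall y, U y -> h y = h' y) ->
    forall y, U y -> \forall z \near y, h z = h' z.
  by move=> hh y Uy; apply: filterS (open_nbhs_nbhs (conj oU Uy)) => z; exact: hh.
elim: k f g fg => [|k IH] f g fg [cf df].
  split=> // y Uy; rewrite /prop_for /continuous_at -fg //.
  exact: cvg_trans (near_eq_cvg (nfg _ _ fg _ Uy)) (cf y Uy).
split=> [y Uy|j].
  rewrite /prop_for /continuous_at -fg //.
  exact: cvg_trans (near_eq_cvg (nfg _ _ fg _ Uy)) (cf y Uy).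
have [dfj Cfj] := df j; split=> [y Uy|].
  by apply: near_eq_derivable (dfj y Uy); exact: (nfg _ _ fg).
by apply: IH Cfj => y Uy; apply: near_eq_derive; exact: (nfg _ _ fg).
Qed.

Lemma Ck_subset (A : set 'rV[R]_n) k f : U `<=` A -> Ck k A f -> Ck k U f.
Proof.
move=> UA; elim: k f => [|k IH] f [cf df]; split=> //.
- by move=> y /UA; exact: cf.
- by move=> y /UA; exact: cf.
- by move=> j; have [dfj /IH] := df j; split=> // y /UA; exact: dfj.
Qed.

Lemma CkD k f g : Ck k U f -> Ck k U g -> Ck k U (f \+ g).
Proof.
elim: k f g => [|k IH] f g [cf df] [cg dg].
  by split=> // y Uy; apply: continuousD; [exact: cf|exact: cg].
split=> [y Uy|j]; first by apply: continuousD; [exact: cf|exact: cg].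
have [dfj Cfj] := df j; have [dgj Cgj] := dg j; split=> [y Uy|].
  by apply: derivableD; [exact: dfj|exact: dgj].
apply: (Ck_eq _ (IH _ _ Cfj Cgj)) => y Uy /=.
by rewrite deriveD //; [exact: dfj|exact: dgj].
Qed.

Lemma CkM k f g : Ck k U f -> Ck k U g -> Ck k U (f \* g).
Proof.
elim: k f g => [|k IH] f g Cf Cg; have [cf df] := Cf; have [cg dg] := Cg.
  by split=> // y Uy; apply: continuousM; [exact: cf|exact: cg].
split=> [y Uy|j]; first by apply: continuousM; [exact: cf|exact: cg].
have [dfj Cfj] := df j; have [dgj Cgj] := dg j; split=> [y Uy|].
  by apply: derivableM; [exact: dfj|exact: dgj].
apply: (Ck_eq _ (CkD (IH _ _ (CkS Cf) Cgj) (IH _ _ (CkS Cg) Cfj))) => y Uy /=.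
by rewrite deriveM //; [exact: dfj|exact: dgj].
Qed.

(** Induction on [k] with [f] fixed: the derivative of [1/f] is [-(1/f)^2] times that of [f], where
    [1/f] reappears one order lower. *)
Lemma CkV k f : (forall y, U y -> f y != 0) -> Ck k U f ->
  Ck k U (fun y => (f y)^-1).
Proof.
move=> f0; elim: k => [|k IH] Cf; have [cf df] := Cf.
  by split=> // y Uy; apply: continuousV; [exact: f0|exact: cf].
split=> [y Uy|j]; first by apply: continuousV; [exact: f0|exact: cf].
have [dfj Cfj] := df j; split=> [y Uy|].
  by apply: derivableV; [exact: f0|exact: dfj].
have Cfi := IH (CkS Cf).
apply: (Ck_eq _ (CkM (CkM (Ck_cst k U (-1)) (CkM Cfi Cfi)) Cfj)) => y Uy /=.
rewrite deriveV //; [|exact: f0|exact: dfj].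
by rewrite mulN1r -expr2 exprVn.
Qed.

End smooth_algebra.

(** * Functions of one real variable, read on row vectors of length one *)

Section one_variable.
Variable R : realType.
Implicit Types f : R -> R.

(** Along the basis vector, both sides are limits of the same difference quotient. *)
Lemma derive_coord0 f (y : 'rV[R]_1) :
  'D_(delta_mx 0 0) (fun z : 'rV[R]_1 => f (z 0 0)) y = (f^`())%classic (y 0 0).
Proof.
rewrite derive1E /derive; set F := (fun h : R => _); set G := (fun h : R => _).
suff -> : F = G by [].
by apply/funext => h; rewrite /F /G /= !mxE.
Qed.

Lemma derivable_coord0 f (y : 'rV[R]_1) :
  derivable (fun z : 'rV[R]_1 => f (z 0 0)) y (delta_mx 0 0) ->
  derivable f (y 0 0) 1.
Proof.
rewrite /derivable; set F := (fun h : R => _); set G := (fun h : R => _).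
suff -> : F = G by [].
by apply/funext => h; rewrite /F /G /= !mxE.
Qed.

Lemma smooth_derive1 (U : set 'rV[R]_1) f :
  smooth U (fun z => f (z 0 0)) ->
  smooth U (fun z => (f^`())%classic (z 0 0)).
Proof.
move=> sf k; have [_ /(_ 0) [_]] := sf k.+1.
by under [fun y => 'D_ _ _ y]eq_fun => y do rewrite derive_coord0.
Qed.

End one_variable.

(** * Coordinate derivatives of constants and of functions of one factor *)

Lemma pd_cst (R : realType) n (M : manifold R n) (i : atlas M) (c : R) a
    (p : M) :
  pd i (fun=> c) a p = 0.
Proof. by rewrite /pd derive_cst. Qed.

Section product_pd.
Variables (R : realType) (m n : nat) (M : manifold R m) (N : manifold R n).
Let P := product_manifold M N.
Implicit Types (i : atlas P) (p : P).

Lemma pd_fst_l i (f : M -> R) a p :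
  pd i (fun q : P => f q.1) (lshift n a) p = pd i.1 f a p.1.
Proof.
rewrite /pd (_ : _ \o _ = (f \o chinv i.1) \o lsubmx) // derive_proj /=.
by rewrite lsubmx_delta_l row_mxKl.
Qed.

Lemma pd_fst_r i (f : M -> R) a p :
  pd i (fun q : P => f q.1) (rshift m a) p = 0.
Proof.
rewrite /pd (_ : _ \o _ = (f \o chinv i.1) \o lsubmx) // derive_proj /=.
by rewrite lsubmx_delta_r derive0v.
Qed.

Lemma pd_snd_l i (f : N -> R) a p :
  pd i (fun q : P => f q.2) (lshift n a) p = 0.
Proof.
rewrite /pd (_ : _ \o _ = (f \o chinv i.2) \o rsubmx) // derive_proj /=.
by rewrite rsubmx_delta_l derive0v.
Qed.

End product_pd.

(** * The Lie derivative along the lift of [v(x) d/dx] *)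

Section vertical_field.
Variables (R : realType) (I : set R) (oI : open I) (n : nat) (N : manifold R n).
Variable v : R -> R.
Let L := interval_manifold oI.
Let M := product_manifold L N.
Let V : vfield M := lift_fst N (vdx oI v).
Implicit Types (i : atlas M) (p : M).

Lemma pd_interval (i : atlas L) (f : R -> R) a (x : L) :
  pd i f a x = (f^`())%classic x.
Proof. by rewrite /pd ord1 derive_coord0 /= mxE. Qed.

Lemma dir_lift_vdx i (f : M -> R) p :
  dir i (V i) f p = v p.1 * pd i f (lshift n 0) p.
Proof.
rewrite /dir big_split_ord /= big_ord1 row_mxEl mxE big1 ?addr0 // => k _.
by rewrite row_mxEr mxE mul0r.
Qed.

Lemma vjac_lift_vdx i p :
  vjac i p V = block_mx ((v^`())%classic p.1)%:M 0 0 0.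
Proof.
apply/matrixP => a b; rewrite mxE.
case: (split_ordP b) => b' ->; last first.
  under [X in pd _ X]eq_fun => q do rewrite row_mxEr mxE.
  rewrite pd_cst; case: (split_ordP a) => a' ->;
    by rewrite ?block_mxEur ?block_mxEdr mxE.
under [X in pd _ X]eq_fun => q do rewrite row_mxEl mxE.
case: (split_ordP a) => a' ->.
  by rewrite block_mxEul (pd_fst_l _ (v : L -> R)) pd_interval !ord1 mxE.
by rewrite block_mxEdl (pd_fst_r _ (v : L -> R)) mxE.
Qed.

(** In the matrix form [lie_mxE], the directional derivative contributes [v h'] and each of the two
    Jacobian terms [h v']. The block of [T] disappears: [V] does not differentiate along [N], and
    its Jacobian is zero there. *)
Lemma lie_lift_vdx (h : R -> R) (T : tensor02 N) i p :
  lie V (fun i p => block_mx (h p.1)%:M 0 0 (T i.2 p.2)) i p =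
  block_mx (v p.1 * (h^`())%classic p.1 + 2 * h p.1 * (v^`())%classic p.1)%:M
    0 0 0.
Proof.
rewrite lie_mxE vjac_lift_vdx tr_block_mx !trmx0 tr_scalar_mx !mulmx_block.
rewrite !(mulmx0, mul0mx, addr0) -!scalar_mxM.
have -> : dirmx i p V (fun q => block_mx (h q.1)%:M 0 0 (T i.2 q.2)) =
    block_mx (v p.1 * (h^`())%classic p.1)%:M 0 0 0 :> 'M[R]_(1 + n).
  apply/matrixP => a b; rewrite mxE dir_lift_vdx.
  case: (split_ordP a) => a' ->; case: (split_ordP b) => b' ->.
  - rewrite !ord1; under [X in pd _ X]eq_fun => q do rewrite block_mxEul mxE.
    by rewrite (pd_fst_l _ (h : L -> R)) pd_interval block_mxEul mxE.
  - under [X in pd _ X]eq_fun => q do rewrite block_mxEur mxE.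
    by rewrite pd_cst mulr0 block_mxEur mxE.
  - under [X in pd _ X]eq_fun => q do rewrite block_mxEdl mxE.
    by rewrite pd_cst mulr0 block_mxEdl mxE.
  - under [X in pd _ X]eq_fun => q do rewrite block_mxEdr.
    by rewrite (pd_snd_l _ (fun q => T i.2 q a' b')) mulr0 block_mxEdr mxE.
rewrite !add_block_mx !addr0 -!raddfD /=; congr (block_mx _%:M _ _ _).
ring.
Qed.

End vertical_field.

(** * The two Lie derivatives and their consequences *)

Theorem proposition2p2 (R : realType) (I : set R) (oI : open I)
    (hI : is_interval I) (n : nat) (N : manifold R n) (ds2 : tensor02 N)
    (hds2 : riemannian_metric ds2) (v : R -> R)
    (hv : smooth_on (M := interval_manifold oI) I v) :
  let M := product_manifold (interval_manifold oI) N in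
  let dxdx : tensor02 M := pull_fst N (dx2 oI) in
  let g : tensor02 M := product_metric (dx2 oI) ds2 in
  let V : vfield M := lift_fst N (vdx oI v) in
  let v' := (v^`())%classic in
  let v'' := (v^`(2))%classic in
  [/\ eq_tensor_on (locus M) (lie V g)
        (tscale (fun p : M => 2 * v' p.1) dxdx),
      eq_tensor_on (locus M) (lie V (lie V g))
        (tscale (fun p : M => 2 * v p.1 * v'' p.1 + 4 * v' p.1 ^+ 2) dxdx),
      mixed_killing_on (locus M `&` [set p : M | v' p.1 != 0]) g V
        (fun p : M => v p.1 * (v'' p.1 / v' p.1) + 2 * v' p.1) &
      (0 < n)%N -> locus N !=set0 ->
        (conformally_killing g V <-> (forall x, I x -> v' x = 0))].

Proof.
move=> M dxdx g V v' v''.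
have Ldx i p (h : R -> R) : lie V (tscale (fun p : M => h p.1) dxdx) i p =
    (v p.1 * (h^`())%classic p.1 + 2 * h p.1 * v' p.1) *: dxdx i p.
  have -> : tscale (fun p : M => h p.1) dxdx =
      fun i p => block_mx (h p.1)%:M 0 0 ((fun _ _ => 0 : 'M[R]_n) i.2 p.2).
    apply/funext => j; apply/funext => q.
    by rewrite /tscale /dxdx /pull_fst scale_block_mx !scaler0 /dx2 scalemx1.
  rewrite (lie_lift_vdx _ _ (fun _ _ => 0)) /dxdx /pull_fst scale_block_mx.
  by rewrite !scaler0 /dx2 scalemx1.
(* An equality of functions, not merely on the locus, so that it can be rewritten under the outer
   [lie]. *)
have Lg : lie V g = tscale (fun p : M => 2 * v' p.1) dxdx.
  apply/funext => i; apply/funext => p.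
  have -> : g = fun i p => block_mx (cst 1 p.1 : R)%:M 0 0 (ds2 i.2 p.2).
    by apply/funext => j; apply/funext => q; rewrite /g product_metricE.
  rewrite lie_lift_vdx derive1_cst mulr0 add0r mulr1.
  by rewrite /tscale /dxdx /pull_fst scale_block_mx !scaler0 /dx2 scalemx1.
(* This is [hv] in the single chart of the interval, with the chart image of [I] made explicit. *)
have sv : smooth [set y : 'rV[R]_1 | I (y 0 0)] (fun y => v (y 0 0)).
  rewrite (_ : [set y | _] = chart (tt : atlas (interval_manifold oI)) @` (I `&` I));
    first exact: hv tt.
  apply/seteqP; split=> [y /= Iy|_ [x [Ix _] <-]] /=; last by rewrite mxE.
  by exists (y 0 0) => //; apply/rowP => k; rewrite mxE ord1.
have sv' := smooth_derive1 sv.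
have sv'' := smooth_derive1 sv'.
have dv' x : I x -> derivable v' x 1.
  move=> Ix; have [_ /(_ 0) [d _]] := sv' 1%N.
  by have := derivable_coord0 (d (const_mx x) _); rewrite /= !mxE; exact.
have LLg : eq_tensor_on (locus M) (lie V (lie V g))
   (tscale (fun p : M => 2 * v p.1 * v'' p.1 + 4 * v' p.1 ^+ 2) dxdx).
  move=> i p _ [Ip _]; rewrite Lg (Ldx _ _ (fun x => 2 * v' x)).
  rewrite /tscale; congr (_ *: _).
  rewrite derive1E deriveMl; last exact: dv'.
  rewrite -derive1E (_ : (v'^`())%classic = v'') //.
  ring.
split=> //.
- by move=> i p _ _; rewrite Lg.
- split.
    (* The factor depends on [x] alone, so it suffices to prove it smooth on [A] and compose with
       [lsubmx]. Continuity of [v'] makes [A] open. *)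
    move=> i; pose A := [set y : 'rV[R]_1 | I (y 0 0) /\ v' (y 0 0) != 0].
    have oA : open A.
      rewrite openE => y [Iy v0]; apply: filterI.
        exact: coord_continuous (open_nbhs_nbhs (conj oI Iy)).
      have [cv' _] := sv' 0%N; exact: cvgr_neq0 (cv' y Iy) v0.
    have AI : A `<=` [set y | I (y 0 0)] by move=> y [].
    pose f (y : 'rV[R]_1) : R :=
      v (y 0 0) * (v'' (y 0 0) / v' (y 0 0)) + 2 * v' (y 0 0).
    suff sf : smooth A f.
      apply: (smooth_lsub _ sf) => _ [[x q] [_ [[Ix _] v0]] <-] /=.
      by rewrite row_mxKl /A /= mxE.
    move=> k.
    have Cv' := Ck_subset AI (sv' k).
    apply: (CkD oA); last by apply: (CkM oA) => //; exact: Ck_cst.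
    apply: (CkM oA); first exact: Ck_subset AI (sv k).
    apply: (CkM oA); first exact: Ck_subset AI (sv'' k).
    by apply: (CkV oA) => // y [].
  move=> i p dp [lp /= v0]; rewrite LLg // Lg /tscale scalerA; congr (_ *: _).
  by field.
- move=> n0 [q Nq]; split=> [[lam [_ E]] x Ix|v0].
    (* At [(x, q)] the block of the interval gives [2 v' = 2 lam], and the diagonal entry of index
       [a] in the block of [N] gives [0 = 2 lam ds2(a, a)]. The index [a] exists because [n] is
       positive. *)
    have [j _ djq] : (\bigcup_j dom j) q by rewrite dom_cover.
    have := E (tt, j) (x, q) (conj Ix djq) (conj Ix Nq).
    rewrite Lg /tscale /g product_metricE /dxdx /pull_fst /= !scale_block_mx.
    move=> /eq_block_mx [/matrixP /(_ 0 0) + _ _ /matrixP].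
    pose a := Ordinal n0; move=> + /(_ a a); rewrite !mxE eqxx !mulr1 mulr0 => v2 l2.
    have [_ _ ds2_gt0] := hds2.
    have /ds2_gt0 : delta_mx 0 a != 0 :> 'rV[R]_n.
      by apply/eqP => /rowP /(_ a) /eqP; rewrite !mxE !eqxx oner_eq0.
    (* [delta_mx 0 a] is the value of the constant field [frame a] at [q], so positivity on it says
       that the diagonal entry of [ds2] is positive. *)
    move=> /(_ j q djq); rewrite (eval_frame (M := N) _ _ _ q q) => /lt0r_neq0 ds2_neq0.
    have /eqP := l2; rewrite -v2 eq_sym mulf_eq0 (negPf ds2_neq0) orbF.
    by rewrite mulf_eq0 pnatr_eq0 => /eqP.
  (* Conversely [lie V g] vanishes on the locus. *)
  exists (fun=> 0); split=> [i|i p _ [Ip _]]; first exact: smooth_cst.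
  by rewrite Lg /tscale v0 // mulr0 !scale0r.
Qed.
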